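(* Let $p$ be a Sophie Germain prime with $p\equiv 3 \pmod 8$, and let $k\geq 1$ be an integer. Then the only non-negative integer solutions of the equation $p^x+(2^{2k}(2p+1))^y=z^2$ are $(p,x,y,z)=(3,1,0,2)$ (for any $k$) and $(p,k,x,y,z)=(3,2,6,1,29)$, $(3,2,2,1,11)$, $(3,3,4,1,23)$.
   Context: A prime $p$ is called a Sophie Germain prime if $2p+1$ is also prime. *)

(* Defs.v *)
From mathcomp Require Import all_boot.

Set Implicit Arguments.
Unset Strict Implicit.
Unset Printing Implicit Defensive.

Definition sophie_germain (p : nat) : bool := prime p && prime (2 * p + 1).

(* Main.v *)
(* Modulo 4 the case y > 0 forces x = 2n, and z^2 - p^(2n) = 4^(ky) (2p+1)^y
   splits as 4 A (A + p^n) with A and A + p^n coprime.  Hence, with q = 2p+1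
   and e = ky - 1, one of p^n + 1 = 4^e q^y, p^n + 4^e = q^y and
   p^n + q^y = 4^e holds.  As p = 3 and q = 7 modulo 8, either e is 1, which
   leaves p | 3, or n (and, in the second equation, y) is even and a
   difference of two squares equals a prime power. *)

Require Import Defs.
From mathcomp Require Import all_boot zify.

Set Implicit Arguments.
Unset Strict Implicit.
Unset Printing Implicit Defensive.

(** * Factorizations of products of prime powers *)

(** Both [s] and [s + d] are powers of [r]. If both exponents were positive, [r] would divide the
    difference [d]; and [s + d = 1] is impossible for positive [s] and [d]. *)
Lemma primeX_factor_eq1 (r s d j : nat) :
  prime r -> 0 < d -> ~~ (r %| d) -> s * (s + d) = r ^ j -> s = 1.
Proof.
move=> r_pr d_gt0 rNd Esd.
have /(dvdn_pfactor _ _ r_pr)[a _ sE] : s %| r ^ j by rewrite -Esd dvdn_mulr.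
have /(dvdn_pfactor _ _ r_pr)[b _ tE] : s + d %| r ^ j.
  by rewrite -Esd dvdn_mull.
case: a sE => [|a] sE; first by rewrite sE.
case: b tE => [|b] tE.
  have : 0 < s by rewrite sE expn_gt0 prime_gt0.
  by move: tE; lia.
by case/negP: rNd; rewrite -(@dvdn_addr s) ?tE ?sE expnS dvdn_mulr.
Qed.

Lemma coprime_dvdn_primeX (r i a b : nat) :
  prime r -> coprime a b -> r ^ i %| a * b -> (r ^ i %| a) || (r ^ i %| b).
Proof.
move=> r_pr co_ab; have [r_a|rNa] := boolP (r %| a).
  have co_rb : coprime (r ^ i) b by apply/coprimeXl/(coprime_dvdl r_a).
  by rewrite Gauss_dvdl // => ->.
by rewrite Gauss_dvdr ?coprimeXl ?prime_coprime // => ->; rewrite orbT.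
Qed.

(** By coprimality each of the two prime powers divides one factor whole, which gives four
    distributions. Cancelling [r ^ i * s ^ j] then forces the remaining cofactors to be 1. *)
Lemma coprime_mul_primeX (r s i j a b : nat) :
  prime r -> prime s -> r != s -> coprime a b -> a * b = r ^ i * s ^ j ->
  [\/ a = 1 /\ b = r ^ i * s ^ j, a = r ^ i /\ b = s ^ j,
      a = s ^ j /\ b = r ^ i | a = r ^ i * s ^ j /\ b = 1].
Proof.
move=> r_pr s_pr r_s co_ab Eab.
have r_gt0 : 0 < r ^ i by rewrite expn_gt0 prime_gt0.
have s_gt0 : 0 < s ^ j by rewrite expn_gt0 prime_gt0.
have co_rs : coprime (r ^ i) (s ^ j).
  by rewrite coprimeXl ?coprimeXr ?prime_coprime ?dvdn_prime2.
have cancel c d : c * d * (r ^ i * s ^ j) = r ^ i * s ^ j -> c = 1 /\ d = 1.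
  rewrite -[RHS]mul1n => /eqP; rewrite eqn_pmul2r ?muln_gt0 ?r_gt0 //.
  by rewrite muln_eq1 => /andP[/eqP-> /eqP->].
have := coprime_dvdn_primeX (i := i) r_pr co_ab.
have := coprime_dvdn_primeX (i := j) s_pr co_ab.
rewrite Eab dvdn_mull // dvdn_mulr // => /(_ isT) s_ab /(_ isT) r_ab.
case/orP: r_ab => r_ab; case/orP: s_ab => s_ab.
- have /dvdnP[c Ec] : r ^ i * s ^ j %| a by rewrite Gauss_dvd ?r_ab.
  have [c1 b1] : c = 1 /\ b = 1 by apply: cancel; rewrite mulnAC -Ec.
  by constructor 4; rewrite Ec c1 mul1n.
- case/dvdnP: r_ab => c Ec; case/dvdnP: s_ab => d Ed.
  have [c1 d1] : c = 1 /\ d = 1 by apply: cancel; rewrite mulnACA -Ec -Ed.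
  by constructor 2; rewrite Ec Ed c1 d1 !mul1n.
- case/dvdnP: r_ab => c Ec; case/dvdnP: s_ab => d Ed.
  have [c1 d1] : c = 1 /\ d = 1.
    by apply: cancel; rewrite mulnACA -Ec -Ed mulnC.
  by constructor 3; rewrite Ec Ed c1 d1 !mul1n.
have /dvdnP[c Ec] : r ^ i * s ^ j %| b by rewrite Gauss_dvd ?r_ab.
have [a1 c1] : a = 1 /\ c = 1 by apply: cancel; rewrite -mulnA -Ec.
by constructor 1; rewrite Ec c1 mul1n.
Qed.

(** * Residues modulo 8 and auxiliary equations *)

Lemma expn_mod8_3 (p n : nat) :
  p = 3 %[mod 8] -> p ^ n %% 8 = if odd n then 3 else 1.
Proof.
move=> p3; elim: n => [|n IHn] //; rewrite expnS -modnMm p3 IHn /=.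
by case: (odd n).
Qed.

Lemma expn_mod8_7 (q n : nat) :
  q = 7 %[mod 8] -> q ^ n %% 8 = if odd n then 7 else 1.
Proof.
move=> q7; elim: n => [|n IHn] //; rewrite expnS -modnMm q7 IHn /=.
by case: (odd n).
Qed.

Lemma even_half (n : nat) : odd n = false -> exists m, n = 2 * m.
Proof. by exists n./2; lia. Qed.

(** The left side is 1 or 5 modulo 8, never 7, so [y] is even; then the squares of two positive
    numbers would differ by 1. *)
Lemma expn4_add1_neq (q y e : nat) :
  q = 7 %[mod 8] -> 4 ^ e.+1 + 1 <> q ^ y.
Proof.
move=> q7 E; have := expn_mod8_7 y q7; rewrite -E expnS.
case: ifP => [_|/even_half[m ym] _]; first lia.
move: E; rewrite ym -[4]/(2 ^ 2) -expnM ![2 * _]mulnC !(expnM _ _ 2) addnC.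
have := expn_gt0 2 e.+1; move: (2 ^ e.+1) (q ^ m) => u v /= u_gt0 E.
have lt_uv : u < v by rewrite -(ltn_exp2r _ _ (isT : 0 < 2)) -E add1n.
by nia.
Qed.

Lemma prime_dvdn_expn (p n c : nat) :
  prime p -> 1 < c -> p ^ n = c -> p %| c.
Proof.
case: n => [|n] p_pr c1 E; first by rewrite -E in c1.
by rewrite -E expnS dvdn_mulr.
Qed.

Lemma odd_lt_diff (m n : nat) :
  odd m -> odd n -> m < n -> exists s, n = m + 2 * s.
Proof. by exists (n - m)./2; lia. Qed.

Lemma muln_eq2 (m n : nat) :
  2 = m * n -> m = 2 /\ n = 1 \/ m = 1 /\ n = 2.
Proof. by case: m => [|[|[|m]]]; case: n => [|[|[|n]]] //; lia. Qed.

(** This settles [y = 0]: [z - 1] and [z + 1] multiply to [p ^ x] and differ by 2, which the odd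
    prime [p] does not divide, so [z - 1 = 1]. *)
Lemma expn_add1_sqr (p x z : nat) :
  prime p -> odd p -> p ^ x + 1 = z ^ 2 -> [/\ p = 3, x = 1 & z = 2].
Proof.
move=> p_pr p_odd E.
have px_gt0 : 0 < p ^ x by rewrite expn_gt0 prime_gt0.
have z_gt1 : 1 < z by nia.
have Es : z.-1 * (z.-1 + 2) = p ^ x by nia.
have z1 : z.-1 = 1.
  apply: primeX_factor_eq1 Es => //; rewrite dvdn_prime2 //.
  by apply: contraTneq p_odd => ->.
have Epx : p ^ x = 3 by rewrite -Es z1.
have p_3 : p = 3.
  by apply/eqP; rewrite -dvdn_prime2 //; apply: prime_dvdn_expn Epx.
split=> //; last lia.
by move/eqP: Epx; rewrite p_3 -[X in _ == X]/(3 ^ 1) eqn_exp2l // => /eqP.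
Qed.

(** * The three exponential equations and the reduction to them *)

Section SophieGermain.

Variables p k : nat.
Hypotheses (p_pr : prime p) (q_pr : prime (2 * p + 1)) (p3 : p = 3 %[mod 8]).

Local Notation q := (2 * p + 1).

Let q7 : q = 7 %[mod 8]. Proof. by move: p3; lia. Qed.

Let p_dvd3 : p %| 3 -> p = 3.
Proof. by rewrite dvdn_prime2 // => /eqP. Qed.

Lemma expn_add1_eq (n e y : nat) :
  e.+1 = k * y -> p ^ n + 1 = 4 ^ e * q ^ y ->
  [/\ p = 3, n = 3, k = 2 & y = 1].
Proof.
move=> ek E; have pn8 := expn_mod8_3 n p3; have qy8 := expn_mod8_7 y q7.
(* [p ^ n + 1] is 2 or 4 modulo 8, whereas [e = 0] would make it odd and [e >= 2] a multiple of
   16. *)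
have e1 : e = 1.
  case: e {ek} E => [|[|e]] //; first by move: pn8 qy8; do 2![case: ifP => _]; lia.
  by rewrite !expnS; move: pn8; case: ifP => _; lia.
subst e; have [[k2 y1]|[k1 y2]] := muln_eq2 ek.
  subst k y; have Ep : p ^ n = 8 * p + 3 by lia.
  have p_3 : p = 3.
    have : p %| 8 * p + 3 by apply: prime_dvdn_expn Ep => //; lia.
    by rewrite dvdn_addr ?dvdn_mull // => /p_dvd3.
  split=> //; move: Ep; rewrite p_3 -[RHS]/(3 ^ 3) => /eqP.
  by rewrite eqn_exp2l // => /eqP.
subst k y; have Ep : p ^ n = p * (16 * p + 16) + 3 by nia.
have p_3 : p = 3.
  have : p %| p * (16 * p + 16) + 3 by apply: prime_dvdn_expn Ep => //; lia.
  by rewrite dvdn_addr ?dvdn_mulr // => /p_dvd3.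
(* The right side is now 195, divisible by 3 but not by 9. *)
move: Ep; rewrite p_3; case: n {E pn8} => [|[|n]] //.
by rewrite !expnS; lia.
Qed.

Lemma expn_add_expn4_eq (n e y : nat) :
  e.+1 = k * y -> p ^ n + 4 ^ e = q ^ y ->
  [/\ p = 3, n = 1, k = 2 & y = 1].
Proof.
move=> ek E; have pn8 := expn_mod8_3 n p3; have qy8 := expn_mod8_7 y q7.
have pn_gt0 : 0 < p ^ n by rewrite expn_gt0 prime_gt0.
case: e ek E => [|[|e]] ek E.
- by move: pn8 qy8; do 2![case: ifP => _]; lia.
- have [[k2 y1]|[k1 y2]] := muln_eq2 ek.
    subst k y; have Ep : p ^ n + 3 = 2 * p by lia.
    case: n Ep {E pn8 pn_gt0} => [|n] Ep; first lia.
    have p_3 : p = 3.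
      apply: p_dvd3; rewrite -(@dvdn_addr (p ^ n.+1)) ?Ep ?dvdn_mull //.
      by rewrite expnS dvdn_mulr.
    split=> //; move: Ep; rewrite p_3; case: n => [|n] //.
    by rewrite !expnS; lia.
  subst k y; case: n E {pn8 pn_gt0} => [|n] E; first nia.
  have p_3 : p = 3.
    apply: p_dvd3; rewrite -(@dvdn_addr (p ^ n.+1)); last first.
      by rewrite expnS dvdn_mulr.
    have -> : p ^ n.+1 + 3 = p * (4 * p + 4) by nia.
    by rewrite dvdn_mulr.
  (* Here [3 ^ n.+1] would be 45, strictly between [3 ^ 3] and [3 ^ 4]. *)
  move: E; rewrite p_3; case: n => [|[|[|n]]] //.
  by rewrite !expnS; lia.
(* The power of 4 now vanishes modulo 8, and the residues 1, 3 of [p ^ n] and 1, 7 of [q ^ y] agree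
   only at 1. *)
have [n_even y_even] : odd n = false /\ odd y = false.
  by move: E pn8 qy8; rewrite !expnS; do 2![case: ifP => _]; lia.
have [l nl] := even_half n_even; have [m ym] := even_half y_even.
have pl_odd : odd (p ^ l) by rewrite oddX; lia.
have qm_odd : odd (q ^ m) by rewrite oddX; lia.
have pl_gt0 : 0 < p ^ l by rewrite expn_gt0 prime_gt0.
move: E; rewrite nl ym [2 * l]mulnC [2 * m]mulnC !(expnM _ _ 2) => E.
have lt_pq : p ^ l < q ^ m.
  by rewrite -(ltn_exp2r _ _ (isT : 0 < 2)) -E -addn1 leq_add2l expn_gt0.
have [s qE] := odd_lt_diff pl_odd qm_odd lt_pq.
have Es : s * (s + p ^ l) = 2 ^ (2 * e.+1).
  move: E; rewrite qE expnM -[2 ^ 2]/4 (expnS 4 e.+1); clear.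
  by move: (4 ^ _) (p ^ l) => u v; nia.
have s1 : s = 1.
  by apply: primeX_factor_eq1 Es => //; rewrite dvdn2 pl_odd.
(* With [s = 1], [p ^ l + 1 = 4 ^ e.+1] and [q ^ m = p ^ l + 2]. *)
case: (@expn4_add1_neq q m e q7).
rewrite qE; move: Es; rewrite s1 expnM -[2 ^ 2]/4; clear.
by move: (4 ^ _) (p ^ l) => u v; lia.
Qed.

Lemma expn_add_expn_eq (n e y : nat) :
  e.+1 = k * y -> p ^ n + q ^ y = 4 ^ e ->
  [/\ p = 3, n = 2, k = 3 & y = 1].
Proof.
move=> ek E; have pn8 := expn_mod8_3 n p3; have qy8 := expn_mod8_7 y q7.
have y_gt0 : 0 < y by case: y ek {E qy8} => //; lia.
have q_le : q <= q ^ y by rewrite -{1}[q]expn1 leq_pexp2l //; lia.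
(* The values 1 and 4 of the right side are too small, since [q] is at least 7. *)
case: e ek E => [|[|e]] ek E; [lia | lia |].
have n_even : odd n = false.
  by move: E pn8 qy8; rewrite !expnS; do 2![case: ifP => _]; lia.
have [l nl] := even_half n_even.
have pl_gt0 : 0 < p ^ l by rewrite expn_gt0 prime_gt0.
have E4 : 4 ^ e.+2 = (2 ^ e.+2) ^ 2 by rewrite -[4]/(2 ^ 2) -!expnM mulnC.
move: E; rewrite E4 nl [2 * l]mulnC expnM => E.
have lt_p2 : p ^ l < 2 ^ e.+2.
  by rewrite -(ltn_exp2r _ _ (isT : 0 < 2)) -E; lia.
(* The factors [2 ^ e.+2 - p ^ l] and [2 ^ e.+2 + p ^ l] of [q ^ y] differ by [2 * p ^ l], which [q]
   does not divide. *)
have s1 : 2 ^ e.+2 - p ^ l = 1.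
  apply: (@primeX_factor_eq1 q _ (2 * p ^ l) y) => //; first lia.
    have q_neq_p : q != p by lia.
    rewrite Euclid_dvdM // dvdn_prime2 // negb_or.
    apply/andP; split; first lia.
    by rewrite Euclid_dvdX // dvdn_prime2 // (negPf q_neq_p).
  move: E; rewrite -(subnKC (ltnW lt_p2)) addKn; clear.
  by move: (p ^ l) (q ^ y) (2 ^ _ - _) => u v w; nia.
have pl8 := expn_mod8_3 l p3.
(* [2 ^ e.+2 = p ^ l + 1] is 2 or 4 modulo 8, hence no multiple of 8. *)
have e0 : e = 0.
  case: e {ek E E4} s1 lt_p2 => // e; rewrite !expnS.
  by move: pl8; case: ifP => _; lia.
subst e; have Epl : p ^ l = 3 by lia.
have p_3 : p = 3 by apply: p_dvd3; apply: prime_dvdn_expn Epl.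
have l1 : l = 1.
  by move/eqP: Epl; rewrite p_3 -[X in _ == X]/(3 ^ 1) eqn_exp2l // => /eqP.
have y1 : y = 1.
  (* Writing 16 as 9 + 7 lets [3 ^ 2] cancel and leaves powers of 7 to compare. *)
  move: E; rewrite Epl p_3 -[(2 ^ 2) ^ 2]/(3 ^ 2 + 7 ^ 1) => /eqP.
  by rewrite eqn_add2l eqn_exp2l // => /eqP.
by split=> //; [rewrite l1 | move: ek; rewrite y1; lia].
Qed.

Lemma sqr_sum_eq (n e y z : nat) :
  e.+1 = k * y -> p ^ (2 * n) + 4 ^ e.+1 * q ^ y = z ^ 2 ->
  [\/ [/\ p = 3, n = 3, k = 2 & y = 1], [/\ p = 3, n = 1, k = 2 & y = 1] |
      [/\ p = 3, n = 2, k = 3 & y = 1]].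
Proof.
move=> ek; rewrite mulnC expnM => E.
have pn_gt0 : 0 < p ^ n by rewrite expn_gt0 prime_gt0.
have pn_odd : odd (p ^ n) by rewrite oddX; lia.
have N_gt0 : 0 < 4 ^ e * q ^ y by rewrite muln_gt0 !expn_gt0; lia.
have z_odd : odd z.
  have <- : odd (z ^ 2) = odd z by rewrite oddX.
  by rewrite -E (expnS 4) -mulnA oddD oddM oddX pn_odd.
have lt_pz : p ^ n < z by rewrite -(ltn_exp2r _ _ (isT : 0 < 2)) -E (expnS 4) -mulnA; lia.
(* With [z = p ^ n + 2 * a], the difference of squares is [4 * a * (a + p ^ n)]; cancelling the 4
   lowers the exponent [e.+1] to [e]. *)
have [a za] := odd_lt_diff pn_odd z_odd lt_pz.
have Ea : a * (a + p ^ n) = 2 ^ (2 * e) * q ^ y.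
  rewrite expnM -[2 ^ 2]/4; move: E; rewrite za (expnS 4) -mulnA; clear.
  by move: (4 ^ e * _) (p ^ n) => u v; nia.
(* A common prime factor could only be [p], which divides neither 2 nor [q]. *)
have co_a : coprime a (a + p ^ n).
  rewrite /coprime gcdnDl -/(coprime _ _) coprime_sym.
  rewrite coprimeXl // prime_coprime //; apply/negP => p_a.
  have : p %| 2 ^ (2 * e) * q ^ y by rewrite -Ea dvdn_mulr.
  rewrite Euclid_dvdM // !Euclid_dvdX // !dvdn_prime2 //.
  by move: p3; clear; lia.
have q_neq2 : 2 != q by lia.
case: (coprime_mul_primeX (isT : prime 2) q_pr q_neq2 co_a Ea) => -[aE bE].
- constructor 1; apply: expn_add1_eq ek _.
  by rewrite -[4]/(2 ^ 2) -expnM -bE aE addnC.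
- constructor 2; apply: expn_add_expn4_eq ek _.
  by rewrite -[4]/(2 ^ 2) -expnM -bE aE addnC.
- constructor 3; apply: expn_add_expn_eq ek _.
  by rewrite -[4]/(2 ^ 2) -expnM -bE aE addnC.
(* The fourth distribution would make [a + p ^ n] equal to 1, although both terms are positive. *)
by move: bE pn_gt0 N_gt0; rewrite aE expnM -[2 ^ 2]/4; clear; lia.
Qed.

End SophieGermain.

Theorem theorem4p2 (p k : nat) (hp : sophie_germain p)
    (hp8 : p = 3 %[mod 8]) (hk : 1 <= k) (x y z : nat) :
  p ^ x + (2 ^ (2 * k) * (2 * p + 1)) ^ y = z ^ 2 <->
  [\/ (p, x, y, z) = (3, 1, 0, 2),
      (p, k, x, y, z) = (3, 2, 6, 1, 29),
      (p, k, x, y, z) = (3, 2, 2, 1, 11) |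
      (p, k, x, y, z) = (3, 3, 4, 1, 23)].
Proof.
case/andP: hp => p_pr q_pr; split=> [E|]; last first.
  by case=> -[-> -> -> ->] // ->.
have [y0|y_gt0] := posnP y.
  constructor 1; move: E; rewrite y0 expn0 => E.
  have p_odd : odd p by lia.
  by have [-> -> ->] := expn_add1_sqr p_pr p_odd E.
have [e ek] : exists e, e.+1 = k * y by exists (k * y).-1; nia.
have E4 : (2 ^ (2 * k) * (2 * p + 1)) ^ y = 4 ^ e.+1 * (2 * p + 1) ^ y.
  by rewrite expnMn -expnM -mulnA -ek expnM.
(* For odd [x] the left side would be 3 modulo 4, which is not a square. *)
have [n xn] : exists n, x = 2 * n.
  apply: even_half; have := expn_mod8_3 x hp8; case: ifP => // _ px3.
  move: E; rewrite E4 expnS -mulnA => E.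
  have : z ^ 2 %% 4 = 3 by rewrite -E; lia.
  rewrite -modnXm; have : z %% 4 < 4 by rewrite ltn_mod.
  by case: (z %% 4) => [|[|[|[|]]]].
(* Once the other unknowns are fixed, [z] is recovered from the computed value of its square. *)
have zE (c : nat) : z ^ 2 = c ^ 2 -> z = c.
  by move/eqP; rewrite eqn_exp2r // => /eqP.
move: (E); rewrite E4 xn => /(sqr_sum_eq p_pr q_pr hp8 ek).
by case=> -[p_3 n_ k_ y_]; subst p n k y x;
  [constructor 2 | constructor 3 | constructor 4];
  congr (_, _); apply: zE; rewrite -E.
Qed.
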